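(* Fix $\kappa>1$. For $t\in\big[\frac{\kappa}{2\kappa+1},\frac{\kappa}{\kappa+2}\big]$ let $\lambda_1(t)=t$, $\lambda_2(t)=1-t\big(1+\frac1\kappa\big)$, $\lambda_3(t)=t/\kappa$, and let $S(t)=-\sum_{i=1}^3\lambda_i(t)\ln\lambda_i(t)$. Then $S$ is strictly concave in $t$. Consequently: (a) The maximum $S_{\max}(\kappa)$ of $S$ on this interval is attained at the unique interior point where $\lambda_2/\lambda_1=\kappa^{-1/(\kappa+1)}$, equivalently at $$\lambda_1^*=\frac1{1+\kappa^{-1/(\kappa+1)}+1/\kappa},\qquad\lambda_2^*=\kappa^{-1/(\kappa+1)}\lambda_1^*,\qquad\lambda_3^*=\lambda_1^*/\kappa.$$ (b) The minimum $S_{\min}(\kappa)$ of $S$ on this interval is attained at one of the two boundary spectra, whose entropies are $$S_P(\kappa)=\frac{2\kappa}{2\kappa+1}\ln\frac{2\kappa+1}{\kappa}+\frac1{2\kappa+1}\ln(2\kappa+1)\qquad(\lambda_1=\lambda_2),$$ $$S_Q(\kappa)=\frac{\kappa}{\kappa+2}\ln\frac{\kappa+2}{\kappa}+\frac2{\kappa+2}\ln(\kappa+2)\qquad(\lambda_2=\lambda_3),$$ and $S_Q(\kappa)<S_P(\kappa)$, so $S_{\min}(\kappa)=S_Q(\kappa)$. Moreover $S_{\min}(\kappa)<S_{\max}(\kappa)$ strictly for every $\kappa>1$, so for $3\times3$ density matrices $\rho$ the condition number $\kappa(\rho)$ (equivalently $\operatorname{OMC}(\rho)$ or $\operatorname{OLC}(\rho)$)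 does not determine the von Neumann entropy $S(\rho)$: the set of entropies over each value $\kappa>1$ is a nondegenerate interval, not a point.
   Context: The family $(\lambda_1(t),\lambda_2(t),\lambda_3(t))$ is exactly the set of triples $\lambda_1\ge\lambda_2\ge\lambda_3>0$ with $\lambda_1+\lambda_2+\lambda_3=1$ and $\lambda_1/\lambda_3=\kappa$, i.e. the spectra of invertible $3\times3$ density matrices $\rho$ (positive, trace $1$) with condition number $\kappa(\rho)=\|\rho\|\,\|\rho^{-1}\|=\kappa$. The lower endpoint in $t$ corresponds to $\lambda_1=\lambda_2$, the upper one to $\lambda_2=\lambda_3$. $\operatorname{OMC}(\rho)=(\kappa(\rho)-1)/(\kappa(\rho)+1)$, $\operatorname{OLC}(\rho)=\tfrac12\ln\kappa(\rho)$, and the von Neumann entropy is $S(\rho)=-\sum_i\lambda_i\ln\lambda_i$ over the eigenvalues of $\rho$. *)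

(* Defs.v *)
From HB Require Import structures.
From mathcomp Require Import all_boot all_order all_algebra.
From mathcomp Require Import sesquilinear spectral.
From mathcomp Require Import all_classical all_reals all_analysis.
From mathcomp Require Import complex.

Set Implicit Arguments.
Unset Strict Implicit.
Unset Printing Implicit Defensive.

Import Order.TTheory GRing.Theory Num.Theory.

Local Open Scope classical_set_scope.
Local Open Scope ring_scope.
Local Open Scope sesquilinear_scope.

Section RealFamily.
Variable R : realType.
Implicit Types (kappa t : R) (s : seq R).

Definition strictly_concave_on (D : set R) (f : R -> R) : Prop :=
  forall x y a : R, D x -> D y -> x != y -> 0 < a -> a < 1 ->
    a * f x + (1 - a) * f y < f (a * x + (1 - a) * y).

(* [ln 0 = 0] in the library, so the convention 0 ln 0 = 0 holds. *)
Definition entropy s : R := - \sum_(x <- s) x * ln x.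

Definition lambda1 kappa t : R := t.
Definition lambda2 kappa t : R := 1 - t * (1 + 1 / kappa).
Definition lambda3 kappa t : R := t / kappa.

Definition tP kappa : R := kappa / (2 * kappa + 1).
Definition tQ kappa : R := kappa / (kappa + 2).

Definition family_entropy kappa t : R :=
  entropy [:: lambda1 kappa t; lambda2 kappa t; lambda3 kappa t].

Definition Smax kappa : R := sup [set family_entropy kappa t | t in `[tP kappa, tQ kappa]%classic].
Definition Smin kappa : R := inf [set family_entropy kappa t | t in `[tP kappa, tQ kappa]%classic].

Definition ratio_star kappa : R := kappa `^ (- (1 / (kappa + 1))).
Definition lambda1_star kappa : R := 1 / (1 + ratio_star kappa + 1 / kappa).
Definition lambda2_star kappa : R := ratio_star kappa * lambda1_star kappa.
Definition lambda3_star kappa : R := lambda1_star kappa / kappa.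

Definition S_P kappa : R :=
  2 * kappa / (2 * kappa + 1) * ln ((2 * kappa + 1) / kappa)
  + 1 / (2 * kappa + 1) * ln (2 * kappa + 1).

Definition S_Q kappa : R :=
  kappa / (kappa + 2) * ln ((kappa + 2) / kappa)
  + 2 / (kappa + 2) * ln (kappa + 2).

End RealFamily.

Section DensityMatrices.
Variables (R : realType) (n : nat).
Implicit Types (A rho : 'M[R[i]]_n) (x : 'cV[R[i]]_n).

Definition positive_semidefinite A : Prop :=
  A \is hermsymmx /\ forall x, 0 <= (x^t* *m A *m x) 0 0.

Definition density_matrix rho : Prop :=
  positive_semidefinite rho /\ \tr rho = 1.

Definition invertible_density rho : Prop :=
  density_matrix rho /\ rho \in unitmx.

(* The norm of [R[i]] is valued in [R[i]], hence the real part. *)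
Definition vnorm x : R := Num.sqrt (\sum_i complex.Re `|x i 0| ^+ 2).

Definition opnorm A : R := sup [set vnorm (A *m x) | x in [set x | vnorm x = 1]].

Definition cond_number rho : R := opnorm rho * opnorm (invmx rho).

Definition OMC rho : R := (cond_number rho - 1) / (cond_number rho + 1).

Definition OLC rho : R := 1 / 2 * ln (cond_number rho).

(* All roots of the characteristic polynomial, with multiplicity. *)
Definition eigenvalues A : seq R[i] :=
  sval (closed_field_poly_normal (char_poly A)).

Definition vn_entropy rho : R := entropy [seq complex.Re z | z <- eigenvalues rho].

Definition entropies_over (f : 'M[R[i]]_n -> R) (c : R) : set R :=
  [set vn_entropy rho | rho in [set rho | invertible_density rho /\ f rho = c]].

Definition determines_entropy (f : 'M[R[i]]_n -> R) : Prop :=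
  exists g : R -> R,
    forall rho, invertible_density rho -> vn_entropy rho = g (f rho).

End DensityMatrices.

(* Main.v *)
(* The tangent-line bound x ln x >= x ln z + x - z, strict for x <> z, gives both
   the strict concavity of the entropy and Gibbs' inequality.  The cross entropy
   of any spectrum of the family relative to lambda_star is constant along the
   family, so Gibbs' inequality identifies lambda_star as the unique maximiser.
   By concavity the minimum is at an endpoint; S_P - S_Q vanishes at kappa = 1 and
   has derivative 6 ln(kappa) (kappa^2 - 1) / ((2 kappa + 1)(kappa + 2))^2 > 0
   beyond it.  The spectral theorem and the unitary invariance of the operator norm
   give kappa(rho) = l1 / l3 for an invertible density matrix with eigenvalues
   l1 >= l2 >= l3 > 0, hence the entropies over kappa are the image of the family,
   an interval by the intermediate value theorem. *)

Require Import Defs.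
From mathcomp Require Import all_boot all_order all_algebra.
From mathcomp Require Import sesquilinear spectral.
From mathcomp Require Import all_classical all_reals all_analysis.
From mathcomp Require Import complex ring lra.

Import Order.TTheory GRing.Theory Num.Theory.
Import numFieldNormedType.Exports.
Local Open Scope classical_set_scope.
Local Open Scope ring_scope.

Set Implicit Arguments.
Unset Strict Implicit.

(** * Entropy along the family *)

Section EntropyFamily.
Variable R : realType.
Implicit Types (k t x y z a : R).

Lemma ln_lt_subr1 x : 0 < x -> x != 1 -> ln x < x - 1.
Proof.
move=> x0 x1; have lx0 : ln x != 0 by rewrite ln_eq0.
by have := expR_gt1Dx lx0; rewrite lnK// ltrBrDl.
Qed.

(** This is [ln u < u - 1] at [u = z / x], multiplied by [x]. *)
Lemma xlnx_gt_tangent x z : 0 < x -> 0 < z -> x != z ->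
  x * ln z + x - z < x * ln x.
Proof.
move=> x0 z0 xz.
have zx1 : z / x != 1.
  by apply: contra xz => /eqP zx; rewrite eq_sym -[z](divfK (lt0r_neq0 x0)) zx mul1r.
have := ln_lt_subr1 (divr_gt0 z0 x0) zx1.
rewrite ln_div ?posrE// -(ltr_pM2l x0) mulrBr mulrBr mulr1 mulrCA divff ?lt0r_neq0//.
lra.
Qed.

Lemma xlnx_ge_tangent x z : 0 < x -> 0 < z -> x * ln z + x - z <= x * ln x.
Proof.
move=> x0 z0; have [->|xz] := eqVneq x z; first by rewrite addrK.
exact/ltW/xlnx_gt_tangent.
Qed.

Lemma convex_comb_gt0 x y a : 0 < x -> 0 < y -> 0 < a -> a < 1 ->
  0 < a * x + (1 - a) * y.
Proof.
by move=> x0 y0 a0 a1; rewrite addr_gt0 ?mulr_gt0 ?subr_gt0.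
Qed.

(** Average the tangent bounds taken at the barycentre [z]: the linear terms cancel. *)
Lemma xlnx_convex x y a : 0 < x -> 0 < y -> 0 < a -> a < 1 ->
  (a * x + (1 - a) * y) * ln (a * x + (1 - a) * y)
    <= a * (x * ln x) + (1 - a) * (y * ln y).
Proof.
move=> x0 y0 a0 a1; have z0 := convex_comb_gt0 x0 y0 a0 a1.
set z := _ + _ in z0 *.
have b0 : 0 <= 1 - a by rewrite subr_ge0 ltW.
have := ler_wpM2l (ltW a0) (xlnx_ge_tangent x0 z0).
have := ler_wpM2l b0 (xlnx_ge_tangent y0 z0).
(* Unfolds [z] only outside the logarithms, so that [ln z] stays an atom for [lra]. *)
rewrite {2 4 5}/z; set L := ln z; lra.
Qed.

(** One strict tangent bound is enough; it is taken at [x], which differs from the barycentre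
    because [a < 1]. *)
Lemma xlnx_strictly_convex x y a : 0 < x -> 0 < y -> x != y -> 0 < a -> a < 1 ->
  (a * x + (1 - a) * y) * ln (a * x + (1 - a) * y)
    < a * (x * ln x) + (1 - a) * (y * ln y).
Proof.
move=> x0 y0 xy a0 a1; have z0 := convex_comb_gt0 x0 y0 a0 a1.
have xz : x != a * x + (1 - a) * y.
  rewrite -subr_eq0 (_ : _ - _ = (1 - a) * (x - y)); last by ring.
  by rewrite mulf_neq0 ?subr_eq0// gt_eqF.
set z := _ + _ in z0 xz *.
have b0 : 0 <= 1 - a by rewrite subr_ge0 ltW.
have : a * (x * ln z + x - z) < a * (x * ln x).
  by rewrite ltr_pM2l//; exact: xlnx_gt_tangent.
have := ler_wpM2l b0 (xlnx_ge_tangent y0 z0).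
rewrite {2 4 5}/z; set L := ln z; lra.
Qed.

Lemma entropy3 x y z : entropy [:: x; y; z] = - (x * ln x + y * ln y + z * ln z).
Proof. by rewrite /entropy !big_cons big_nil addr0 addrA. Qed.

(* S_P x - S_Q x, with the logarithms of x collected. *)
Let gap x := ln (2 * x + 1) - ln (x + 2) - 3 * x * ln x / ((2 * x + 1) * (x + 2)).

(** With [D = (2 * x + 1) * (x + 2)], the two outer logarithms contribute [3 / D], which cancels the
    term from differentiating [ln x]. What is left is [- 3 * ln x * (D - x * D') / D ^+ 2], and
    [D - x * D' = 2 - 2 * x ^+ 2]. *)
Lemma is_derive_gap x : 0 < x ->
  is_derive x 1 gap
    (6 * ln x * (x ^+ 2 - 1) / ((2 * x + 1) * (x + 2)) ^+ 2).
Proof.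
move=> x0; have p0 : 0 < x + 2 by lra.
have q0 : 0 < 2 * x + 1 by lra.
have d1 : is_derive x 1 (fun y : R => 2 * y + 1) 2.
  have := is_deriveD (is_deriveM (is_derive_cst (2 : R) x 1) (is_derive_id x 1))
    (is_derive_cst (1 : R) x 1).
  by move=> H; apply: (is_derive_eq H); rewrite /GRing.scale/=; ring.
have d2 : is_derive x 1 (fun y : R => y + 2) 1.
  have H := is_deriveD (is_derive_id x 1) (is_derive_cst (2 : R) x 1).
  by apply: (is_derive_eq H); rewrite addr0.
have dl1 := @is_derive1_comp R (@ln R) _ x _ _ (is_derive1_ln q0) d1.
have dl2 := @is_derive1_comp R (@ln R) _ x _ _ (is_derive1_ln p0) d2.
have dl := is_derive1_ln x0.
have qp : (2 * x + 1) * (x + 2) != 0 by rewrite mulf_neq0// gt_eqF.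
have dV := @is_deriveV R (fun y : R => (2 * y + 1) * (y + 2)) x _ 1 qp (is_deriveM d1 d2).
have := is_deriveB (is_deriveB dl1 dl2)
  (is_deriveM (is_deriveM (is_deriveM (is_derive_cst (3 : R) x 1) (is_derive_id x 1)) dl) dV).
move=> H; apply: (is_derive_eq H).
(* Products of functions are evaluated at [x] by conversion, so that [field] sees ring
   expressions. *)
rewrite /GRing.scale /= -[(_ * ln (R:=R)) x]/(3 * x * ln x) -[(cst 3 * id) x]/(3 * x).
field; rewrite !gt_eqF//.
Qed.

(** * The one-parameter family at a fixed condition number *)

Section FixedCondition.
Variables (k : R) (k1 : 1 < k).

Let k0 : 0 < k. Proof. exact: lt_trans k1. Qed.
Let kN0 : k != 0. Proof. exact: lt0r_neq0. Qed.

Lemma tP_gt0 : 0 < tP k.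
Proof. by rewrite divr_gt0// addr_gt0// mulr_gt0. Qed.

Lemma tP_lt_tQ : tP k < tQ k.
Proof.
by rewrite /tP /tQ ltr_pM2l// ltf_pV2 ?posrE; move: k1 k0; lra.
Qed.

(** Each endpoint encodes one ordering: [t <= tQ k] is [lambda3 <= lambda2], and [tP k <= t] is
    [lambda2 <= lambda1]. This form links the interval to ordered spectra. *)
Lemma mem_family t :
  (t \in `[tP k, tQ k]) = (lambda3 k t <= lambda2 k t <= lambda1 k t).
Proof.
rewrite in_itv /= /lambda1 /lambda2 /lambda3 /tP /tQ andbC.
have kp : 0 < k + 2 by move: k0; lra.
have kq : 0 < 2 * k + 1 by move: k0; lra.
rewrite ler_pdivlMr// ler_pdivrMr// -(ler_pM2r k0 (t / k)) divfK//.
rewrite -(ler_pM2r k0 _ t).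
have -> : (1 - t * (1 + 1 / k)) * k = k - t * (k + 1) by field.
by congr (_ && _); apply/idP/idP; lra.
Qed.

Lemma lambdas_sum t : lambda1 k t + lambda2 k t + lambda3 k t = 1.
Proof. by rewrite /lambda1 /lambda2 /lambda3; field. Qed.

Lemma family_gt0 t : t \in `[tP k, tQ k] ->
  [/\ 0 < lambda1 k t, 0 < lambda2 k t & 0 < lambda3 k t].
Proof.
move=> tI; have t0 : 0 < t.
  by apply: lt_le_trans tP_gt0 _; move: tI; rewrite in_itv => /andP[].
have l3 : 0 < lambda3 k t by exact: divr_gt0.
by split=> //; apply: lt_le_trans l3 _; move: tI; rewrite mem_family => /andP[].
Qed.

(** Each eigenvalue is affine in [t], so [x ln x] stays convex along the family; strictness comes
    from [lambda1], which is [t] itself. *)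
Lemma family_entropy_strictly_concave :
  strictly_concave_on `[tP k, tQ k]%classic (family_entropy k).
Proof.
move=> x y a /= xI yI xy a0 a1.
have [x1 x2 x3] := family_gt0 xI; have [y1 y2 y3] := family_gt0 yI.
rewrite /family_entropy !entropy3.
have -> : lambda1 k (a * x + (1 - a) * y) =
  a * lambda1 k x + (1 - a) * lambda1 k y by [].
have -> : lambda2 k (a * x + (1 - a) * y) =
  a * lambda2 k x + (1 - a) * lambda2 k y by rewrite /lambda2; field.
have -> : lambda3 k (a * x + (1 - a) * y) =
  a * lambda3 k x + (1 - a) * lambda3 k y by rewrite /lambda3; field.
have := xlnx_strictly_convex x1 y1 xy a0 a1.
have := xlnx_convex x2 y2 a0 a1.
have := xlnx_convex x3 y3 a0 a1.
lra.
Qed.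

(** In exponential form the claim is [0 < ln k / (k + 1) < ln k]. *)
Lemma ratio_star_bounds : 1 / k < ratio_star k < 1.
Proof.
have lk := ln_gt0 k1.
have k10 : 0 < k + 1 by move: k0; lra.
have kV : 1 / k = expR (- ln k) by rewrite expRN lnK ?posrE// div1r.
have lk1 : 0 < 1 / (k + 1) * ln k by rewrite mulr_gt0// divr_gt0.
rewrite /ratio_star /powR gt_eqF// mulNr kV -[X in _ < _ < X]expR0 !ltr_expR.
rewrite oppr_lt0 ltrN2 lk1 andbT mulrC mulrA mulr1 ltr_pdivrMr// ltr_pMr//.
by move: k0; lra.
Qed.

Let r0 : 0 < ratio_star k. Proof. exact: powR_gt0. Qed.

Let den0 : 0 < 1 + ratio_star k + 1 / k.
Proof. by rewrite !addr_gt0// divr_gt0. Qed.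

Lemma lambda1_star_gt0 : 0 < lambda1_star k.
Proof. exact: divr_gt0. Qed.

(** Compare reciprocals: [2 + 1 / k], [1 + r + 1 / k] and [1 + 2 / k], where [r] is the starred
    ratio and [1 / k < r < 1]. *)
Lemma lambda1_star_bounds : tP k < lambda1_star k < tQ k.
Proof.
have /andP[r1 r2] := ratio_star_bounds.
have -> : tP k = (2 + 1 / k)^-1.
  by rewrite /tP; field; rewrite kN0 /= !gt_eqF//; move: k0; lra.
have -> : tQ k = (1 + 2 / k)^-1.
  by rewrite /tQ; field; rewrite kN0 /= !gt_eqF//; move: k0; lra.
have i0 : 0 < 1 / k by rewrite divr_gt0.
rewrite /lambda1_star [1 / (_ + _)]div1r !ltf_pV2 ?posrE//; last 2 first.
- by move: i0; lra.
- by move: i0; lra.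
by apply/andP; split; move: r1 r2; lra.
Qed.

Lemma lambda1_star_in : lambda1_star k \in `[tP k, tQ k].
Proof. by rewrite in_itv/= !ltW//; case/andP: lambda1_star_bounds. Qed.

Lemma lambda2_lambda1_star : lambda2 k (lambda1_star k) = lambda2_star k.
Proof.
by rewrite /lambda2 /lambda2_star /lambda1_star; field; rewrite kN0/=;
   apply: lt0r_neq0; move: (mulr_gt0 k0 den0);
    rewrite !mulrDr mulr1 mulrCA divff// mulr1; lra.
Qed.

(** Cleared of denominators, the ratio condition is the linear equation
    [t * (1 + r + 1 / k) = 1]. *)
Lemma ratio_eq_star t : t \in `[tP k, tQ k] ->
  lambda2 k t / lambda1 k t = ratio_star k <-> t = lambda1_star k.
Proof.
move=> /family_gt0[t0 _ _]; rewrite /lambda1 in t0 *; split=> [|->]; last first.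
  by rewrite lambda2_lambda1_star mulfK// lt0r_neq0// lambda1_star_gt0.
move=> /(congr1 (fun x => x * t)); rewrite divfK ?lt0r_neq0// /lambda2 => e.
rewrite /lambda1_star; apply: (mulIf (lt0r_neq0 den0)).
rewrite divfK ?lt0r_neq0//; lra.
Qed.

Lemma lambda3_lambda1_star : lambda3 k (lambda1_star k) = lambda3_star k.
Proof. by []. Qed.

(* The cross entropy of the spectrum at t relative to the starred spectrum does
   not depend on t, so Gibbs' inequality alone gives the maximiser. *)
Lemma cross_entropy_star t :
  lambda1 k t * ln (lambda1_star k) + lambda2 k t * ln (lambda2_star k)
    + lambda3 k t * ln (lambda3_star k)
  = ln (lambda1_star k) - ln k / (k + 1).
Proof.
have L0 := lambda1_star_gt0.
rewrite /lambda2_star /lambda3_star ln_div ?posrE// lnM ?posrE// ln_powR.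
by rewrite /lambda1 /lambda2 /lambda3; field; rewrite kN0/= gt_eqF//; move: k0; lra.
Qed.

(** Add the tangent bounds of the three eigenvalues at their starred values. Both spectra sum to 1,
    so the linear terms vanish, and the remaining cross entropy has the same value at [t] as at the
    star. *)
Lemma family_entropy_lt_star t : t \in `[tP k, tQ k] -> t != lambda1_star k ->
  family_entropy k t < family_entropy k (lambda1_star k).
Proof.
move=> tI tN; have [t1 t2 t3] := family_gt0 tI.
have [s1 s2 s3] := family_gt0 lambda1_star_in.
rewrite /family_entropy !entropy3.
have := xlnx_gt_tangent t1 s1 tN.
have := xlnx_ge_tangent t2 s2.
have := xlnx_ge_tangent t3 s3.
have := lambdas_sum t; have := lambdas_sum (lambda1_star k).
have := cross_entropy_star t; have := cross_entropy_star (lambda1_star k).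
rewrite lambda2_lambda1_star lambda3_lambda1_star /lambda1.
lra.
Qed.

(** * Endpoint spectra and the minimum *)

Lemma family_entropy_tP : family_entropy k (tP k) = S_P k.
Proof.
have kq : 0 < 2 * k + 1 by move: k0; lra.
have -> : S_P k = - (2 * (tP k * ln (tP k)) + (2 * k + 1)^-1 * ln (2 * k + 1)^-1).
  rewrite /S_P /tP ln_div ?posrE// ln_div ?posrE// lnV ?posrE//.
  by field; rewrite gt_eqF.
rewrite /family_entropy entropy3 /lambda1.
have -> : lambda2 k (tP k) = tP k by rewrite /lambda2 /tP; field; rewrite kN0 gt_eqF.
have -> : lambda3 k (tP k) = (2 * k + 1)^-1.
  by rewrite /lambda3 /tP; field; rewrite kN0 gt_eqF.
lra.
Qed.

Lemma lambda12_tP : lambda1 k (tP k) = lambda2 k (tP k).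
Proof.
have kq : 0 < 2 * k + 1 by move: k0; lra.
by rewrite /lambda1 /lambda2 /tP; field; rewrite kN0 gt_eqF.
Qed.

Lemma lambda23_tQ : lambda2 k (tQ k) = lambda3 k (tQ k).
Proof.
have kp : 0 < k + 2 by move: k0; lra.
by rewrite /lambda2 /lambda3 /tQ; field; rewrite kN0 gt_eqF.
Qed.

Lemma family_entropy_tQ : family_entropy k (tQ k) = S_Q k.
Proof.
have kp : 0 < k + 2 by move: k0; lra.
have l3 : lambda3 k (tQ k) = (k + 2)^-1.
  by rewrite /lambda3 /tQ; field; rewrite kN0 gt_eqF.
rewrite /family_entropy entropy3 lambda23_tQ l3 /lambda1 /S_Q /tQ.
rewrite ln_div ?posrE// ln_div ?posrE// lnV ?posrE//.
by field; rewrite gt_eqF.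
Qed.

Lemma family_entropy_gt_endpoints t : tP k < t < tQ k ->
  Num.min (S_P k) (S_Q k) < family_entropy k t.
Proof.
(* [a] is the weight of [tP k] when [t] is written as a convex combination of the endpoints. *)
move=> /andP[Pt tQt]; set a := (tQ k - t) / (tQ k - tP k).
have d0 : 0 < tQ k - tP k by rewrite subr_gt0 tP_lt_tQ.
have a0 : 0 < a by rewrite divr_gt0// subr_gt0.
have a1 : a < 1 by rewrite ltr_pdivrMr// mul1r; move: Pt; lra.
have PI : `[tP k, tQ k]%classic (tP k) by rewrite /= in_itv/= lexx ltW// tP_lt_tQ.
have QI : `[tP k, tQ k]%classic (tQ k) by rewrite /= in_itv/= lexx ltW// tP_lt_tQ.
have PQ : tP k != tQ k by rewrite lt_eqF// tP_lt_tQ.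
have := family_entropy_strictly_concave PI QI PQ a0 a1.
have -> : a * tP k + (1 - a) * tQ k = t by rewrite /a; field; rewrite gt_eqF.
rewrite family_entropy_tP family_entropy_tQ; apply: le_lt_trans.
have mP : Num.min (S_P k) (S_Q k) <= S_P k by rewrite ge_min lexx.
have mQ : Num.min (S_P k) (S_Q k) <= S_Q k by rewrite ge_min lexx orbT.
have := ler_wpM2l (ltW a0) mP.
have b0 : 0 <= 1 - a by rewrite subr_ge0 ltW.
have := ler_wpM2l b0 mQ; lra.
Qed.

(** The mean value theorem on [[1, k]] makes the difference [k - 1] times the derivative of [gap] at
    some [c > 1], where [ln c] and [c ^+ 2 - 1] are positive. *)
Lemma S_Q_lt_S_P : S_Q k < S_P k.
Proof.
have kp : 0 < k + 2 by move: k0; lra.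
have kq : 0 < 2 * k + 1 by move: k0; lra.
have gE : S_P k - S_Q k = gap k.
  rewrite /S_P /S_Q /gap !ln_div ?posrE//; field.
  by rewrite !gt_eqF.
have g1 : gap 1 = 0 by rewrite /gap ln1 mulr1 (addrC 2) subrr mulr0 mul0r subr0.
have dg x : x \in `]1, k[ -> is_derive x 1 gap
    (6 * ln x * (x ^+ 2 - 1) / ((2 * x + 1) * (x + 2)) ^+ 2).
  by rewrite in_itv/= => /andP[x1 _]; apply: is_derive_gap; apply: lt_trans x1.
have cg : {within `[1, k], continuous gap}.
  apply: continuous_in_subspaceT => x; rewrite inE/= in_itv/= => /andP[x1 _].
  have x0 : 0 < x by apply: lt_le_trans x1.
  by apply/differentiable_continuous/derivable1_diffP; have [] := is_derive_gap x0.
have [c] := MVT k1 dg cg.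
rewrite g1 subr0 -gE in_itv/= => /andP[c1 _] /eqP; rewrite -subr_gt0 => /eqP ->.
have c0 : 0 < c by apply: lt_trans c1.
rewrite mulr_gt0 ?subr_gt0// divr_gt0 ?mulr_gt0 ?ln_gt0 ?subr_gt0 ?exprn_gt0//
  ?mulr_gt0 ?exprn_egt1//; lra.
Qed.

Lemma family_entropy_ge_tQ t : t \in `[tP k, tQ k] -> S_Q k <= family_entropy k t.
Proof.
rewrite in_itv/= => /andP[]; rewrite le_eqVlt => /predU1P[<- _|Pt].
  by rewrite family_entropy_tP ltW// S_Q_lt_S_P.
rewrite le_eqVlt => /predU1P[->|tQt]; first by rewrite family_entropy_tQ.
have := @family_entropy_gt_endpoints t; rewrite Pt tQt => /(_ isT)/ltW.
by rewrite min_r// ltW// S_Q_lt_S_P.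
Qed.

Lemma family_entropy_le_star t : t \in `[tP k, tQ k] ->
  family_entropy k t <= family_entropy k (lambda1_star k).
Proof.
move=> tI; have [->//|tN] := eqVneq t (lambda1_star k).
exact/ltW/family_entropy_lt_star.
Qed.

Let tQ_in : tQ k \in `[tP k, tQ k].
Proof. by rewrite in_itv/= lexx ltW// tP_lt_tQ. Qed.

Lemma SmaxE : Smax k = family_entropy k (lambda1_star k).
Proof.
have ub : ubound [set family_entropy k t | t in `[tP k, tQ k]%classic]
    (family_entropy k (lambda1_star k)).
  by move=> _ [t tI <-]; exact: family_entropy_le_star.
have mem : [set family_entropy k t | t in `[tP k, tQ k]%classic]
    (family_entropy k (lambda1_star k)).
  by exists (lambda1_star k) => //; exact: lambda1_star_in.
apply/eqP; rewrite eq_le; apply/andP; split.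
  by apply: ge_sup => //; exists (family_entropy k (lambda1_star k)).
by apply: ub_le_sup => //; exists (family_entropy k (lambda1_star k)).
Qed.

Lemma SminE : Smin k = S_Q k.
Proof.
have lb : lbound [set family_entropy k t | t in `[tP k, tQ k]%classic] (S_Q k).
  by move=> _ [t tI <-]; exact: family_entropy_ge_tQ.
have mem : [set family_entropy k t | t in `[tP k, tQ k]%classic] (S_Q k).
  by exists (tQ k); [exact: tQ_in|exact: family_entropy_tQ].
apply/eqP; rewrite eq_le; apply/andP; split.
  by apply: ge_inf => //; exists (S_Q k).
by apply: lb_le_inf => //; exists (S_Q k).
Qed.

Lemma Smin_lt_Smax : Smin k < Smax k.
Proof.
rewrite SminE SmaxE -family_entropy_tQ; apply: family_entropy_lt_star => //.
by rewrite gt_eqF//; case/andP: lambda1_star_bounds.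
Qed.

(** All three eigenvalues are positive even at the endpoints, so [ln] is only met where it is
    continuous. *)
Lemma continuous_family_entropy t : t \in `[tP k, tQ k] ->
  {for t, continuous (family_entropy k)}.
Proof.
move=> /family_gt0[l1 l2 l3].
have xlnx (f : R -> R) : {for t, continuous f} -> 0 < f t ->
    {for t, continuous (fun y => f y * ln (f y))}.
  move=> cf f0; apply: continuousM => //.
  by apply: (@continuous_comp _ _ _ f (@ln R)) => //; exact: continuous_ln.
have c1 : {for t, continuous (lambda1 k)} by exact: cvg_id.
have c2 : {for t, continuous (lambda2 k)}.
  apply: continuousB; first exact: cvg_cst.
  by apply: continuousM => //; exact: cvg_cst.
have c3 : {for t, continuous (lambda3 k)}.
  by apply: continuousM => //; exact: cvg_cst.
have -> : family_entropy k = (fun y => - (lambda1 k y * ln (lambda1 k y)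
    + lambda2 k y * ln (lambda2 k y) + lambda3 k y * ln (lambda3 k y))).
  by apply/funext => y; rewrite /family_entropy entropy3.
apply: continuousN; apply: continuousD; last exact: xlnx.
by apply: continuousD; exact: xlnx.
Qed.

(** The intermediate value theorem is applied on [[lambda1_star k, tQ k]] only: its ends already
    carry the maximum and the minimum. *)
Lemma family_entropy_image :
  [set family_entropy k t | t in `[tP k, tQ k]%classic] = `[Smin k, Smax k]%classic.
Proof.
apply/seteqP; split=> [_ [t tI <-]|y]; rewrite /= in_itv/=.
  by rewrite SminE SmaxE family_entropy_ge_tQ// family_entropy_le_star.
rewrite SminE SmaxE -family_entropy_tQ => yI.
have /andP[Ps sQ] := lambda1_star_bounds.
have sub x : x \in `[lambda1_star k, tQ k] -> x \in `[tP k, tQ k].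
  by rewrite !in_itv/= => /andP[sx ->]; rewrite (le_trans (ltW Ps) sx).
have [||c cI <-] := @IVT R (family_entropy k) _ _ y (ltW sQ).
- apply: continuous_in_subspaceT => x; rewrite inE => /sub.
  exact: continuous_family_entropy.
- have le := family_entropy_le_star tQ_in.
  by rewrite min_r// max_l.
- by exists c => //; exact: sub.
Qed.

End FixedCondition.
End EntropyFamily.

(** * Spectra and condition numbers of density matrices *)

Local Open Scope sesquilinear_scope.
Local Open Scope complex_scope.

(** The similarity lifts to polynomial matrices, where it commutes with the scalar matrix of
    ['X]. *)
Lemma char_poly_conj (K : comUnitRingType) n (P A : 'M[K]_n) : P \in unitmx ->
  char_poly (invmx P *m A *m P) = char_poly A.
Proof.
move=> uP; rewrite /char_poly /char_poly_mx.
set Q := map_mx polyC P; set Q' := map_mx polyC (invmx P).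
have QQ : Q' *m Q = 1%:M by rewrite -map_mxM mulVmx// map_mx1.
have -> : 'X%:M - map_mx polyC (invmx P *m A *m P)
    = Q' *m ('X%:M - map_mx polyC A) *m Q.
  rewrite mulmxBr mulmxBl scalar_mxC -(mulmxA 'X%:M) QQ mulmx1.
  by rewrite !map_mxM.
by rewrite !det_mulmx mulrAC -det_mulmx QQ det1 mul1r.
Qed.

Lemma invmx_eq (K : comUnitRingType) n (A B : 'M[K]_n) :
  A *m B = 1%:M -> invmx B = A.
Proof.
move=> AB; have [_ uB] := mulmx1_unit AB.
by rewrite -[LHS]mul1mx -AB mulmxK.
Qed.

Section Matrices.
Variable R : realType.

(** [eigenvalues] is a chosen list of roots, hence known only up to order; unique factorisation into
    linear factors gives the permutation. *)
Lemma eigenvalues_conj_diag n (P : 'M[R[i]]_n) (d : 'rV[R[i]]_n) : P \in unitmx ->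
  perm_eq (eigenvalues (invmx P *m diag_mx d *m P)) [seq d 0 i | i <- enum 'I_n].
Proof.
move=> uP; apply: prod_XsubC_eq; rewrite /eigenvalues.
case: closed_field_poly_normal => s /=.
rewrite char_poly_conj// (monicP (char_poly_monic _)) scale1r => <-.
rewrite char_poly_trig ?diag_mx_is_trig// big_map big_enum /=.
by apply: eq_bigr => i _; rewrite mxE eqxx.
Qed.

Lemma entropy_perm (s1 s2 : seq R) : perm_eq s1 s2 -> entropy s1 = entropy s2.
Proof. by move=> s12; rewrite /entropy (perm_big _ s12). Qed.

(** * Euclidean norm and operator norm *)

Lemma vnorm_ge0 n (x : 'cV[R[i]]_n) : 0 <= vnorm x.
Proof. exact: sqrtr_ge0. Qed.

Lemma vnorm_sqr n (x : 'cV[R[i]]_n) : (vnorm x ^+ 2)%:C = \sum_i `|x i 0| ^+ 2.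
Proof.
rewrite sqr_sqrtr; last by apply: sumr_ge0 => i _; exact: sqr_ge0.
by rewrite rmorph_sum; apply: eq_bigr => i _; rewrite rmorphXn.
Qed.

Lemma vnorm_sqrE n (x : 'cV[R[i]]_n) : (vnorm x ^+ 2)%:C = (x^t* *m x) 0 0.
Proof.
by rewrite vnorm_sqr mxE; apply: eq_bigr => i _; rewrite !mxE normCKC.
Qed.

Lemma eq_vnorm m n (x : 'cV[R[i]]_m) (y : 'cV[R[i]]_n) :
  x^t* *m x = y^t* *m y -> vnorm x = vnorm y.
Proof.
move=> xy; apply/eqP; rewrite -(@eqrXn2 _ 2) ?vnorm_ge0//; apply/eqP.
by apply: complexI; rewrite !vnorm_sqrE xy.
Qed.

Lemma vnorm_unitary n (P : 'M[R[i]]_n) (x : 'cV[R[i]]_n) : P \is unitarymx ->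
  vnorm (P *m x) = vnorm x.
Proof.
move=> /unitarymxP/mulmx1C PP; apply: eq_vnorm.
by rewrite trmx_mul map_mxM mulmxA -(mulmxA _ _ P) PP mulmx1.
Qed.

(** [P] maps the unit sphere onto itself and [invmx P] preserves norms, so both suprema run over the
    same set. *)
Lemma opnorm_unitary n (P A : 'M[R[i]]_n) : P \is unitarymx ->
  opnorm (invmx P *m A *m P) = opnorm A.
Proof.
move=> uP; have uP' : invmx P \is unitarymx by rewrite invmx_unitary// trmxC_unitary.
have iP := unitarymx_unit uP.
congr sup; apply/seteqP; split=> _ [x /= x1 <-].
- exists (P *m x); first by rewrite /= vnorm_unitary.
  by rewrite -!mulmxA (vnorm_unitary _ uP').
- exists (invmx P *m x); first by rewrite /= vnorm_unitary.
  by rewrite -!mulmxA mulKVmx// vnorm_unitary.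
Qed.

(** The bound holds coordinatewise on squares and is attained at the [i]-th basis vector. *)
Lemma opnorm_diag n (d : 'rV[R[i]]_n) (r : R) i :
  (forall j, `|d 0 j| <= r%:C) -> `|d 0 i| = r%:C -> opnorm (diag_mx d) = r.
Proof.
move=> dr di; have r0 : 0 <= r by rewrite -ler0c (le_trans _ (dr i)).
have DE x j : (diag_mx d *m x) j 0 = d 0 j * x j 0 :> R[i].
  by rewrite mul_diag_mx mxE.
have ub : ubound [set vnorm (diag_mx d *m x) | x in [set x | vnorm x = 1]] r.
  move=> _ [x /= x1 <-]; rewrite -(@ler_pXn2r _ 2) ?nnegrE ?vnorm_ge0//.
  rewrite -lecR vnorm_sqr -[r ^+ 2]mulr1 -(expr1n R 2) -x1 rmorphM rmorphXn /=.
  rewrite vnorm_sqr mulr_sumr.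
  apply: ler_sum => j _; rewrite DE normrM exprMn ler_wpM2r ?exprn_ge0//.
  by rewrite ler_pXn2r ?nnegrE// ler0c.
have vdelta (c : R[i]) : vnorm (c *: delta_mx i 0 : 'cV_n) = complex.Re `|c|.
  apply/eqP; rewrite -(@eqrXn2 _ 2) ?vnorm_ge0//; last first.
    by rewrite -ler0c RRe_real ?normr_real.
  apply/eqP/complexI; rewrite vnorm_sqr (bigD1 i)//= big1 ?addr0.
    by rewrite !mxE !eqxx mulr1 rmorphXn.
  by move=> j ji; rewrite !mxE (negbTE ji) mulr0 normr0 expr0n.
have mem : [set vnorm (diag_mx d *m x) | x in [set x | vnorm x = 1]] r.
  (* The scalar 1 lets [vdelta] compute the norm of the witness as well as that of its image. *)
  exists (1 *: delta_mx i 0); rewrite /= ?vdelta ?normr1//.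
  rewrite scale1r (_ : _ *m _ = d 0 i *: delta_mx i 0) ?vdelta ?di//.
  apply/matrixP => j k; rewrite ord1 DE !mxE.
  by case: eqVneq => [->|]//; rewrite !mulr0.
apply/eqP; rewrite eq_le; apply/andP; split.
  by apply: ge_sup => //; exists r.
by apply: ub_le_sup => //; exists r.
Qed.

Let toC n (d : 'rV[R]_n) : 'rV[R[i]]_n := map_mx (real_complex R) d.

Lemma opnorm_diag_real n (d : 'rV[R]_n) i :
  (forall j, 0 < d 0 j) -> (forall j, d 0 j <= d 0 i) ->
  opnorm (diag_mx (toC d)) = d 0 i.
Proof.
move=> d0 di; have nE j : `|toC d 0 j| = (d 0 j)%:C.
  by rewrite mxE ger0_norm// ler0c ltW.
by apply: (@opnorm_diag _ _ _ i) => [j|]; rewrite nE// lecR.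
Qed.

(** * Unitary conjugates of positive diagonal matrices *)

Section UnitaryConjugate.
Variables (n : nat) (P : 'M[R[i]]_n) (d : 'rV[R]_n).
Hypotheses (uP : P \is unitarymx) (d0 : forall j, 0 < d 0 j).
Let rho := invmx P *m diag_mx (toC d) *m P.
Let iP : P \in unitmx := unitarymx_unit uP.

Lemma vn_entropy_conj : vn_entropy rho = entropy [seq d 0 j | j <- enum 'I_n].
Proof.
have -> : [seq d 0 j | j <- enum 'I_n]
    = [seq complex.Re z | z <- [seq toC d 0 j | j <- enum 'I_n]].
  by rewrite -map_comp; apply: eq_map => j; rewrite /= mxE.
exact/entropy_perm/perm_map/eigenvalues_conj_diag.
Qed.

Let diag_unit : diag_mx (toC d) \in unitmx.
Proof.
rewrite unitmxE det_diag unitfE prodf_seq_neq0; apply/allP => j _ /=.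
by rewrite mxE gt_eqF// ltcR.
Qed.

Lemma cond_number_conj i j :
  (forall l, d 0 l <= d 0 i) -> (forall l, d 0 j <= d 0 l) ->
  cond_number rho = d 0 i / d 0 j.
Proof.
move=> di dj; rewrite /cond_number opnorm_unitary// (opnorm_diag_real d0 di).
congr (_ * _).
(* The inverse has the reciprocal spectrum in the same basis, so its norm is read off at the
   smallest eigenvalue, index [j]. *)
have -> : invmx rho = invmx P *m diag_mx (toC (\row_l (d 0 l)^-1)) *m P.
  apply: invmx_eq; rewrite /rho -!mulmxA mulKVmx// (mulmxA (diag_mx _)).
  rewrite mulmx_diag (_ : \row_l _ = const_mx 1).
    by rewrite diag_const_mx mul1mx mulVmx.
  by apply/rowP => l; rewrite !mxE fmorphV/= mulVf// gt_eqF// ltcR.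
rewrite opnorm_unitary// (@opnorm_diag_real _ _ j) => [|l|l]; rewrite !mxE//.
  by rewrite invr_gt0.
by rewrite lef_pV2 ?posrE.
Qed.

Lemma invertible_density_conj : \sum_j d 0 j = 1 -> invertible_density rho.
Proof.
move=> s1; have rhoE : rho = P^t* *m diag_mx (toC d) *m P.
  by rewrite /rho invmx_unitary.
split; last by rewrite /rho !unitmx_mul unitmx_inv iP diag_unit.
split; last first.
  rewrite mxtrace_mulC mulmxA mulmxV// mul1mx mxtrace_diag.
  rewrite -[RHS](rmorph1 (real_complex R)) -s1 rmorph_sum.
  by apply: eq_bigr => j _; rewrite mxE.
split.
  apply/is_hermitianmxP; rewrite expr0 scale1r rhoE !trmx_mul !map_mxM !mulmxA.
  rewrite trmxCK tr_diag_mx map_diag_mx; congr (_ *m diag_mx _ *m _).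
  by apply/rowP => j; rewrite !mxE; apply/esym/CrealP; rewrite ger0_real// ler0c ltW.
(* The quadratic form at [x] is the sum of the [d 0 j] times the squared moduli of the coordinates
   of [P *m x]. *)
move=> x; rewrite rhoE !mulmxA -mulmxA -map_mxM -trmx_mul -mulmxA mul_diag_mx mxE.
apply: sumr_ge0 => j _; rewrite !mxE mulrCA -normCKC.
by rewrite mulr_ge0 ?exprn_ge0// ler0c ltW.
Qed.

End UnitaryConjugate.

Lemma invertible_density_spectral n (rho : 'M[R[i]]_n) : invertible_density rho ->
  exists P (d : 'rV[R]_n), [/\ P \is unitarymx, forall j, 0 < d 0 j,
    \sum_j d 0 j = 1 & rho = invmx P *m diag_mx (toC d) *m P].
Proof.
move=> [[[herm psd] tr1] unit]; set P := spectralmx rho; set sp := spectral_diag rho.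
have uP : P \is unitarymx := spectral_unitarymx rho.
have iP : P \in unitmx := unitarymx_unit uP.
have rhoE : rho = invmx P *m diag_mx sp *m P.
  exact/orthomx_spectralP/hermitian_normalmx.
have sp_ge0 j : 0 <= sp 0 j.
  (* At the [j]-th eigenvector the quadratic form equals [sp 0 j]. *)
  have := psd (invmx P *m delta_mx j 0).
  rewrite trmx_mul map_mxM {1}rhoE !mulmxA invmx_unitary// trmxCK mulmxtVK// mulmxtVK//.
  rewrite -mulmxA mul_diag_mx mxE (bigD1 j)//= big1 ?addr0.
    by rewrite !mxE !eqxx mulr1 rmorph1 mul1r.
  by move=> l lj; rewrite !mxE (negbTE lj) !mulr0.
have sp_gt0 j : 0 < sp 0 j.
  rewrite lt_def sp_ge0 andbT; apply: contraTneq unit => sj.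
  rewrite rhoE !unitmx_mul unitmx_inv iP andbT/= unitmxE det_diag.
  by rewrite (bigD1 j)//= sj mul0r unitr0.
(* Nonnegative elements of [R[i]] are real, so taking real parts loses nothing. *)
pose d : 'rV[R]_n := map_mx (@complex.Re R) sp.
have dE j : sp 0 j = (d 0 j)%:C by rewrite mxE RRe_real// ger0_real.
have {}rhoE : rho = invmx P *m diag_mx (toC d) *m P.
  by rewrite rhoE; congr (_ *m diag_mx _ *m _); apply/rowP => j; rewrite [RHS]mxE dE.
exists P, d; split => //; first by move=> j; rewrite -ltcR -dE.
apply: complexI; rewrite rmorph1 -tr1 rhoE mxtrace_mulC mulmxA mulmxV// mul1mx mxtrace_diag.
by rewrite rmorph_sum; apply: eq_bigr => j _; rewrite [RHS]mxE.
Qed.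

Lemma invertible_density3 (rho : 'M[R[i]]_3) : invertible_density rho ->
  exists l1 l2 l3 : R, [/\ 0 < l3 <= l2, l2 <= l1, l1 + l2 + l3 = 1,
    vn_entropy rho = entropy [:: l1; l2; l3] & cond_number rho = l1 / l3].
Proof.
move=> /invertible_density_spectral[P [d [uP d0 s1 ->]]].
set e := [seq d 0 j | j <- enum 'I_3].
(* The spectral theorem gives no order on the eigenvalues; sorting them decreasingly yields [l1],
   [l2], [l3]. *)
have pe : perm_eq (sort >=%R e) e by rewrite perm_sort.
have : sorted >=%R (sort >=%R e) by apply: sort_sorted => x y; exact: le_total.
have : size (sort >=%R e) = 3 by rewrite size_sort size_map size_enum_ord.
move: pe; case: (sort _ e) => [//|l1 [//|l2 [//|l3 []//]]] pe _ /=.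
rewrite andbT => /andP[l21 l32].
have mem x : x \in [:: l1; l2; l3] -> exists j, d 0 j = x.
  by rewrite (perm_mem pe) => /mapP[j _ ->]; exists j.
have [i iE] : exists j, d 0 j = l1 by apply: mem; rewrite !inE eqxx.
have [k kE] : exists j, d 0 j = l3 by apply: mem; rewrite !inE eqxx !orbT.
have bounds j : l3 <= d 0 j <= l1.
  have : d 0 j \in [:: l1; l2; l3] by rewrite (perm_mem pe) map_f// mem_enum.
  rewrite !inE => /or3P[] /eqP ->; rewrite ?lexx ?l21 ?l32 ?andbT//=;
    exact: le_trans l32 l21.
exists l1, l2, l3; split.
- by rewrite -{1}kE d0.
- by [].
- rewrite -s1 -big_enum /= -(big_map (d 0) xpredT id) -(perm_big _ pe) /=.
  by rewrite !big_cons big_nil addr0 addrA.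
- by rewrite vn_entropy_conj//; apply/entropy_perm; rewrite perm_sym.
- rewrite (@cond_number_conj _ _ _ uP d0 i k) ?iE ?kE// => j.
    by case/andP: (bounds j).
  by case/andP: (bounds j).
Qed.

Lemma ex_invertible_density3 (l1 l2 l3 : R) : 0 < l3 -> l3 <= l2 -> l2 <= l1 ->
  l1 + l2 + l3 = 1 ->
  exists rho : 'M[R[i]]_3, [/\ invertible_density rho,
    vn_entropy rho = entropy [:: l1; l2; l3] & cond_number rho = l1 / l3].
Proof.
move=> l30 l32 l21 s1; pose d : 'rV[R]_3 := \row_j [:: l1; l2; l3]`_j.
have l20 := lt_le_trans l30 l32; have l10 := lt_le_trans l20 l21.
have l31 := le_trans l32 l21.
have d0 j : 0 < d 0 j by rewrite mxE; case: j => [[|[|[|]]]].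
have u1 : (1%:M : 'M[R[i]]_3) \is unitarymx.
  by apply/unitarymxP; rewrite trmx1 map_mx1 mulmx1.
(* A diagonal matrix, written as a conjugate by the identity so that the results on unitary
   conjugates apply. *)
exists (invmx 1%:M *m diag_mx (toC d) *m 1%:M); split.
- by apply: invertible_density_conj => //; rewrite !big_ord_recl big_ord0 !mxE /= addr0 addrA.
- rewrite vn_entropy_conj//; congr entropy.
  by rewrite !enum_ordSl enum_ord0 /= !mxE.
- rewrite (@cond_number_conj _ _ _ u1 d0 ord0 ord_max) ?mxE//= => j;
  by rewrite !mxE; case: j => [[|[|[|]]]].
Qed.

End Matrices.

(** * Entropies over a given condition number *)

Section EntropyRange.
Variable R : realType.
Implicit Types kappa : R.

Lemma entropies_over_cond_number kappa : 1 < kappa ->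
  entropies_over (@cond_number R 3) kappa = `[Smin kappa, Smax kappa]%classic.
Proof.
move=> k1; have k0 : 0 < kappa := lt_trans ltr01 k1.
rewrite -family_entropy_image//; apply/seteqP; split=> [_ [rho [inv ck] <-]|_ [t tI <-]].
  have [l1 [l2 [l3 [/andP[l30 l32] l21 s1 -> cE]]]] := invertible_density3 inv.
  (* The ratio [l1 / l3 = kappa] and the unit trace force the spectrum to be the family member with
     [t = l1]. *)
  have l3E : l3 = lambda3 kappa l1.
    rewrite /lambda3 -ck cE invf_div mulrCA divff ?mulr1// gt_eqF//.
    by rewrite (lt_le_trans l30)// (le_trans l32).
  have l2E : l2 = lambda2 kappa l1.
    by have := lambdas_sum k1 l1; rewrite -l3E /lambda1; lra.
  exists l1; last by rewrite /family_entropy -l2E -l3E.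
  suff : l1 \in `[tP kappa, tQ kappa] by [].
  by rewrite mem_family// -l2E -l3E l32 l21.
have [t1 t2 t3] := family_gt0 k1 tI.
have : t \in `[tP kappa, tQ kappa] by [].
rewrite mem_family// => /andP[t32 t21].
have [rho [inv eE cE]] := ex_invertible_density3 t3 t32 t21 (lambdas_sum k1 t).
exists rho => //; split=> //; rewrite cE /lambda3 /lambda1 invf_div mulrCA divff ?mulr1//.
exact: lt0r_neq0.
Qed.

Lemma cond_number_gt0 (rho : 'M[R[i]]_3) : invertible_density rho -> 0 < cond_number rho.
Proof.
move=> /invertible_density3[l1 [l2 [l3 [/andP[l30 l32] l21 _ _ ->]]]].
by rewrite divr_gt0// (lt_le_trans l30)// (le_trans l32).
Qed.

Lemma eq_entropies_over n (f g : 'M[R[i]]_n -> R) (c c' : R) :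
  (forall rho, invertible_density rho -> f rho = c <-> g rho = c') ->
  entropies_over f c = entropies_over g c'.
Proof.
move=> fg; apply/seteqP; split=> _ [rho [inv e] <-]; exists rho => //.
  by split=> //; apply/fg.
by split=> //; apply/fg.
Qed.

(** The map from [c] to [(c - 1) / (c + 1)] is injective on positive reals, so [OMC] and the
    condition number have the same fibres. *)
Lemma entropies_over_OMC kappa : 0 < kappa ->
  entropies_over (@OMC R 3) ((kappa - 1) / (kappa + 1))
    = entropies_over (@cond_number R 3) kappa.
Proof.
move=> k0; apply: eq_entropies_over => rho /cond_number_gt0 c0.
have d0 (x : R) : 0 < x -> x + 1 != 0 by move=> x0; rewrite lt0r_neq0// addr_gt0.
rewrite /OMC; split=> [/eqP|->//].
by rewrite (eqr_div _ _ (d0 _ c0) (d0 _ k0)) => /eqP; lra.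
Qed.

Lemma entropies_over_OLC kappa : 0 < kappa ->
  entropies_over (@OLC R 3) (1 / 2 * ln kappa)
    = entropies_over (@cond_number R 3) kappa.
Proof.
move=> k0; apply: eq_entropies_over => rho /cond_number_gt0 c0.
rewrite /OLC; split=> [e|->//].
by apply: ln_inj; rewrite ?posrE//; move: e; lra.
Qed.

(** A determining function would send [c] to both ends of the interval. *)
Lemma not_determines_entropy n (f : 'M[R[i]]_n -> R) (a b c : R) : a < b ->
  entropies_over f c = `[a, b]%classic -> ~ determines_entropy f.
Proof.
move=> ab fE [g gE].
have val x : x \in `[a, b] -> x = g c.
  move=> xI; have [rho [inv <-] <-] : entropies_over f c x by rewrite fE.
  exact: gE.
have aE : a = g c by apply: val; rewrite in_itv/= lexx ltW.
have bE : b = g c by apply: val; rewrite in_itv/= lexx ltW.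
by move: ab; rewrite aE bE ltxx.
Qed.

End EntropyRange.

Unset Implicit Arguments.

Theorem proposition5p14 (R : realType) :
  (forall kappa : R, 1 < kappa ->
    [/\ strictly_concave_on `[tP kappa, tQ kappa]%classic (family_entropy kappa),
        (* (a) *)
        [/\ tP kappa < lambda1_star kappa < tQ kappa,
            forall t : R, t \in `[tP kappa, tQ kappa] ->
              lambda2 kappa t / lambda1 kappa t = kappa `^ (- (1 / (kappa + 1)))
              <-> t = lambda1_star kappa,
            [/\ lambda1 kappa (lambda1_star kappa) = lambda1_star kappa,
                lambda2 kappa (lambda1_star kappa) = lambda2_star kappa
              & lambda3 kappa (lambda1_star kappa) = lambda3_star kappa],
            family_entropy kappa (lambda1_star kappa) = Smax kappa
          & forall t : R, t \in `[tP kappa, tQ kappa] ->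
              family_entropy kappa t <= Smax kappa /\
              (family_entropy kappa t = Smax kappa -> t = lambda1_star kappa)],
        (* (b) *)
        [/\ (forall t : R, t \in `[tP kappa, tQ kappa] ->
              Smin kappa <= family_entropy kappa t) /\
            (family_entropy kappa (tP kappa) = Smin kappa \/
             family_entropy kappa (tQ kappa) = Smin kappa),
            lambda1 kappa (tP kappa) = lambda2 kappa (tP kappa) /\
            family_entropy kappa (tP kappa) = S_P kappa,
            lambda2 kappa (tQ kappa) = lambda3 kappa (tQ kappa) /\
            family_entropy kappa (tQ kappa) = S_Q kappa,
            S_Q kappa < S_P kappa
          & Smin kappa = S_Q kappa],
        Smin kappa < Smax kappa
      & [/\ entropies_over (@cond_number R 3) kappa = `[Smin kappa, Smax kappa]%classic,
            entropies_over (@OMC R 3) ((kappa - 1) / (kappa + 1))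
              = `[Smin kappa, Smax kappa]%classic
          & entropies_over (@OLC R 3) (1 / 2 * ln kappa)
              = `[Smin kappa, Smax kappa]%classic]])
  /\ [/\ ~ determines_entropy (@cond_number R 3),
         ~ determines_entropy (@OMC R 3)
       & ~ determines_entropy (@OLC R 3)].
Proof.
split=> [kappa k1|].
  have k0 : 0 < kappa := lt_trans ltr01 k1.
  split.
  - exact: family_entropy_strictly_concave.
  - split.
    + exact: lambda1_star_bounds.
    + by move=> t tI; exact: ratio_eq_star.
    + by split=> //; exact: lambda2_lambda1_star.
    + by rewrite SmaxE.
    + move=> t tI; rewrite SmaxE//; split; first exact: family_entropy_le_star.
      by move=> e; apply/eqP; apply: contra_eqT e => tN; rewrite lt_eqF ?family_entropy_lt_star.
  - split.
    + split=> [t tI|]; first by rewrite SminE// family_entropy_ge_tQ.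
      by right; rewrite SminE// family_entropy_tQ.
    + by split; [exact: lambda12_tP|exact: family_entropy_tP].
    + by split; [exact: lambda23_tQ|exact: family_entropy_tQ].
    + exact: S_Q_lt_S_P.
    + exact: SminE.
  - exact: Smin_lt_Smax.
  - by rewrite entropies_over_OMC// entropies_over_OLC// entropies_over_cond_number.
(* One fibre suffices for the negative claims; the value 2 is an arbitrary choice above 1. *)
have lt12 : 1 < 2 :> R by rewrite ltr1n.
have lt02 : 0 < 2 :> R by [].
have range := entropies_over_cond_number lt12.
split.
- exact: not_determines_entropy (Smin_lt_Smax lt12) range.
- apply: (not_determines_entropy (Smin_lt_Smax lt12)); rewrite -range.
  exact: entropies_over_OMC.
- apply: (not_determines_entropy (Smin_lt_Smax lt12)); rewrite -range.
  exact: entropies_over_OLC.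
Qed.
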